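(* Suppose $\Sigma_0,\Sigma_1\subset\mathbb{R}^{n+1}$ are complete, properly embedded $n$-dimensional shrinkers, i.e. smooth hypersurfaces satisfying $\vec H=-\tfrac12 x^\perp$, where $\vec H$ is the Euclidean mean curvature vector and $x^\perp$ the normal component of the position vector. Then $$\overline{B^{n+1}_{2\sqrt n}}\cap\Sigma_0\cap\Sigma_1\neq\emptyset,$$ where $B^{n+1}_{2\sqrt n}$ is the open Euclidean ball of radius $2\sqrt n$ centered at the origin. *)

(* Defs.v *)
From HB Require Import structures.
From mathcomp Require Import all_boot all_order all_algebra.
From mathcomp Require Import all_classical all_reals all_analysis.
Set Implicit Arguments. Unset Strict Implicit. Unset Printing Implicit Defensive.
Import Order.TTheory GRing.Theory Num.Theory.
Import numFieldNormedType.Exports.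
Local Open Scope classical_set_scope.
Local Open Scope ring_scope.

Section Defs.
Variables (R : realType) (n : nat).
Notation V := 'rV[R]_(n.+1).

Definition evec (i : 'I_(n.+1)) : V := delta_mx 0 i.

Definition dotp (x y : V) : R := \sum_i x 0 i * y 0 i.
Definition enorm (x : V) : R := Num.sqrt (dotp x x).

Definition pderiv (i : 'I_(n.+1)) (f : V -> R) : V -> R :=
  fun x => 'D_(evec i) f x.

Fixpoint iter_pderiv (l : seq 'I_(n.+1)) (f : V -> R) : V -> R :=
  match l with
  | [::] => f
  | i :: l' => pderiv i (iter_pderiv l' f)
  end.

Definition smooth_on (U : set V) (f : V -> R) : Prop :=
  forall (l : seq 'I_(n.+1)) (x : V), U x -> differentiable (iter_pderiv l f) x.

Definition grad (F : V -> R) (x : V) : V := \row_i pderiv i F x.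

Definition unit_normal (F : V -> R) (x : V) : V := (enorm (grad F x))^-1 *: grad F x.

Definition divergence (X : V -> V) (x : V) : R :=
  \sum_i pderiv i (fun y => X y 0 i) x.

(* Euclidean mean curvature vector of the level set {F = F x} at x:
   H = - (div nu) nu   (e.g. for the round sphere it points inward) *)
Definition mean_curv_vec (F : V -> R) (x : V) : V :=
  - (divergence (unit_normal F) x) *: unit_normal F x.

Definition normal_part (F : V -> R) (x : V) : V :=
  dotp x (unit_normal F x) *: unit_normal F x.

(* Sigma is a smooth embedded hypersurface, locally given as a regular level set
   {F = 0} of a smooth F with nonvanishing gradient, and along which the
   shrinker equation  H = -1/2 x^perp  holds. *)
Definition shrinker_locally (S : set V) : Prop :=
  forall p, S p ->
    exists (U : set V) (F : V -> R),
      [/\ open U, U p, smooth_on U F,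
          (forall x, U x -> grad F x != 0) &
          ((forall x, U x -> (S x <-> F x = 0)) /\
           (forall x, U x -> S x ->
             mean_curv_vec F x = - (2^-1) *: normal_part F x))].

(* complete, properly embedded (nonempty) n-dimensional shrinker in R^{n+1}:
   a nonempty closed subset which is an embedded smooth hypersurface satisfying
   the shrinker equation *)
Definition shrinker (S : set V) : Prop :=
  [/\ S !=set0, closed S & shrinker_locally S].

End Defs.

(* Main.v *)
Require Import Defs.
From HB Require Import structures.
From mathcomp Require Import all_boot all_order all_algebra.
From mathcomp Require Import all_classical all_reals all_analysis.
From mathcomp Require Import ring lra.
Import Order.TTheory GRing.Theory Num.Theory.
Import numFieldNormedType.Exports.
Local Open Scope classical_set_scope.
Local Open Scope ring_scope.
Set Implicit Arguments. Unset Strict Implicit. Unset Printing Implicit Defensive.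

(** Put u(x) = 4n - |x|^2. If the two shrinkers do not meet in the closed ball
    {u >= 0}, then u(x) u(y) / |x - y|^2, a decreasing function of the hyperbolic
    distance of the ball, attains its maximum m on S0 x S1 at a pair (p, q) of
    interior points. The polynomial u(x) u(y) - m |x - y|^2 is then maximal at
    (p, q). By the first-order conditions the reflection in the hyperplane
    orthogonal to p - q exchanges the two tangent spaces; adding up the second
    variations along the pairs (e, reflected e), for e in a tight frame of the
    tangent space of S0 at p, and inserting the mean curvatures -x^perp / 2, one
    gets u(q) |p|^2 + u(p) |q|^2 <= 0, hence p = q = 0, which is absurd.
    Both shrinkers do enter the open ball (for n > 0), since at the point closest
    to the origin the same test applied to |x|^2 gives |x|^2 <= 2n.
    No parametrization is needed: curves p + s e + k s^2 g with k determined up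
    to o(1) by the Hessian of a defining function are found by the intermediate
    value theorem. *)

(** * A one-sided second-derivative test on the real line *)

Lemma near_right_pos_of_derive2_gt0 (R : realType) (f df : R -> R) (d : R) :
  (\forall x \near (0 : R), is_derive (x : R) (1 : R) f (df x)) ->
  f 0 = 0 -> df 0 = 0 -> is_derive (0 : R) (1 : R) df d -> 0 < d ->
  \forall s \near (0 : R)^'+, 0 < f s.
Proof.
move=> Hf f0 df0 Hd d0.
(* The quotient [df x / x] tends to [d], so [df] is positive just to the right of 0; the mean value
   theorem then writes [f s] as [df c * s] with [0 < c < s]. *)
have /= : \forall x \near (0 : R)^', 0 < x^-1 * df x.
  have [D1 D2] := Hd.
  have : (fun h : R => h^-1 *: (df (h *: 1 + 0) - df 0)) @ 0^' --> d.
    by rewrite -D2; exact: D1.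
  move=> /cvgr_gt /(_ 0 d0); apply: filterS => x /=.
  by rewrite df0 subr0 addr0 /GRing.scale /= mulr1.
move: Hf => /nbhs_ballP [e1 /= e10 H1] /nbhs_ballP [e2 /= e20 H2].
near=> s.
have s0 : 0 < s by [].
have s1 : s < e1 by near: s; exact: nbhs_right_lt.
have s2 : s < e2 by near: s; exact: nbhs_right_lt.
have H1' x : 0 <= x -> x <= s -> is_derive x (1 : R) f (df x).
  move=> x0 xs; apply: H1; rewrite /ball /= sub0r normrN ger0_norm //.
  exact: le_lt_trans s1.
have [||c] := @MVT R f df 0 s s0.
- by move=> x; rewrite in_itv /= => /andP[x0 xs]; apply: H1'; exact: ltW.
- apply: derivable_within_continuous => x; rewrite in_itv /= => /andP[x0 xs].
  by have [] := H1' x x0 xs.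
rewrite in_itv /= => /andP[c0 cs]; rewrite f0 !subr0 => ->.
apply: mulr_gt0 => //.
have : 0 < c^-1 * df c.
  apply: H2 => /=; last by rewrite gt_eqF.
  by rewrite /ball /= sub0r normrN gtr0_norm //; exact: lt_trans s2.
by rewrite pmulr_rgt0 // invr_gt0.
Unshelve. all: by end_near. Qed.

Lemma near_right_neg_of_derive2_lt0 (R : realType) (f df : R -> R) (d : R) :
  (\forall x \near (0 : R), is_derive (x : R) (1 : R) f (df x)) ->
  f 0 = 0 -> df 0 = 0 -> is_derive (0 : R) (1 : R) df d -> d < 0 ->
  \forall s \near (0 : R)^'+, f s < 0.
Proof.
move=> Hf f0 df0 Hd d0.
have : \forall s \near (0 : R)^'+, 0 < (- f) s.
  apply: (near_right_pos_of_derive2_gt0 (df := - df) (d := - d)).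
  - by apply: filterS Hf => x Hx; apply: is_derive_eq (is_deriveN Hx) _.
  - by rewrite -[LHS]/(- f 0) f0 oppr0.
  - by rewrite -[LHS]/(- df 0) df0 oppr0.
  - by rewrite oppr_gt0.
by apply: filterS => s; rewrite -[X in 0 < X]/(- f s) oppr_gt0.
Qed.

(** * Differentiation along parabolas *)

Section Calculus.
Variables (R : realType) (n : nat).
Notation V := 'rV[R]_(n.+1).
Implicit Types (p e g x v : V) (F : V -> R).

(** The coefficient [c] is an argument on a par with [s]: points of a hypersurface are reached with
    a [c] that depends on [s], and only its limit is known. *)
Definition parabola p e g (c s : R) : V := p + s *: e + (c * s ^+ 2) *: g.

Lemma is_diff_parabola p e g c s :
  is_diff s (parabola p e g c) (fun h => h *: (e + (2 * c * s) *: g)).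
Proof.
have k2 : is_diff s (c *: (id ^+ 2) : R -> R) (c *: (2 * s ^+ 1 *: id)).
  exact: is_diffZ (is_diffX 1 (is_diff_id s)).
have := is_diffD (is_diffD (is_diff_cst p s) (is_diff_scalel s e))
  (is_diff_comp k2 (is_diff_scalel _ g)).
move/is_diff_eq; apply.
apply/funext => h; rewrite /= add0r.
rewrite scalerDr [in RHS]scalerA; congr (_ + _ *: _).
rewrite -[LHS]/(c * (2 * s ^+ 1 * h)) expr1; ring.
Qed.

Lemma diff_sum_pderiv F x v : differentiable F x ->
  'd F x v = \sum_i v 0 i * pderiv i F x.
Proof.
move=> dF; rewrite [in LHS](row_sum_delta v) linear_sum /=.
apply: eq_bigr => i _; rewrite linearZ /= /pderiv deriveE //.
Qed.

Lemma is_derive_parabola p e g c s F : differentiable F (parabola p e g c s) ->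
  is_derive s (1 : R) (F \o parabola p e g c)
    (\sum_i (e + (2 * c * s) *: g) 0 i * pderiv i F (parabola p e g c s)).
Proof.
move=> dF; have D := is_diff_parabola p e g c s.
have [D1 D2] := D.
have Dc : differentiable (F \o parabola p e g c) s by apply: differentiable_comp.
apply: DeriveDef; first exact: diff_derivable.
rewrite deriveE // diff_comp //= D2 scale1r; exact: diff_sum_pderiv.
Qed.

Lemma derive_comp_real (h : R -> R) (h' : R) F x v :
  differentiable F x -> is_derive (F x) (1 : R) h h' ->
  derivable (h \o F) x v /\ 'D_v (h \o F) x = h' * 'D_v F x.
Proof.
move=> dF [h1 h2].
have dh : differentiable h (F x) by apply/derivable1_diffP.
have dc : differentiable (h \o F) x by apply: differentiable_comp.
split; first exact: diff_derivable.
rewrite deriveE // diff_comp //= deriv1E // derive1E h2 deriveE // mulrC //.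
Qed.

End Calculus.

(** * The Euclidean inner product and quadratic forms *)

Section Dotp.
Variables (R : realType) (n : nat).
Notation V := 'rV[R]_(n.+1).
Implicit Types (x y z v : V) (M : 'M[R]_(n.+1)).

Lemma dotpE x y : dotp x y = (x *m y^T) 0 0.
Proof. by rewrite mxE; apply: eq_bigr => i _; rewrite mxE. Qed.

Lemma dotpC x y : dotp x y = dotp y x.
Proof. by apply: eq_bigr => i _; rewrite mulrC. Qed.

Lemma dotpDl x y z : dotp (x + y) z = dotp x z + dotp y z.
Proof. by rewrite /dotp -big_split; apply: eq_bigr => i _; rewrite mxE mulrDl. Qed.

Lemma dotpZl a x y : dotp (a *: x) y = a * dotp x y.
Proof. by rewrite /dotp mulr_sumr; apply: eq_bigr => i _; rewrite mxE mulrA. Qed.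

Lemma dotpNl x y : dotp (- x) y = - dotp x y.
Proof. by rewrite -scaleN1r dotpZl mulN1r. Qed.

Lemma dotpDr x y z : dotp x (y + z) = dotp x y + dotp x z.
Proof. by rewrite dotpC dotpDl !(dotpC x). Qed.

Lemma dotpZr a x y : dotp x (a *: y) = a * dotp x y.
Proof. by rewrite dotpC dotpZl dotpC. Qed.

Lemma dotpNr x y : dotp x (- y) = - dotp x y.
Proof. by rewrite dotpC dotpNl dotpC. Qed.

Lemma dotp0l x : dotp 0 x = 0.
Proof. by rewrite -(scale0r (0 : V)) dotpZl mul0r. Qed.

Lemma dotp0r x : dotp x 0 = 0.
Proof. by rewrite dotpC dotp0l. Qed.

Definition dotp_linear := (dotpDl, dotpDr, dotpNl, dotpNr, dotpZl, dotpZr).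

Lemma dotp_ge0 x : 0 <= dotp x x.
Proof. by apply: sumr_ge0 => i _; rewrite -expr2 sqr_ge0. Qed.

Lemma dotp_eq0 x : (dotp x x == 0) = (x == 0).
Proof.
apply/idP/idP => [|/eqP->]; last by rewrite /dotp big1 // => i _; rewrite mxE mul0r.
rewrite psumr_eq0 => [/allP H|i _]; last by rewrite -expr2 sqr_ge0.
apply/eqP/rowP => i; rewrite mxE; apply/eqP.
by have := H i (mem_index_enum _); rewrite /= mulf_eq0 orbb.
Qed.

Lemma dotp_gt0 x : (0 < dotp x x) = (x != 0).
Proof. by rewrite lt_def dotp_ge0 andbT dotp_eq0. Qed.

Definition quad M v : R := (v *m M *m v^T) 0 0.

Lemma quadE M v : quad M v = \sum_i \sum_j v 0 i * v 0 j * M j i.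
Proof.
rewrite /quad mxE; apply: eq_bigr => i _; rewrite !mxE mulr_suml.
by apply: eq_bigr => j _; rewrite mulrC mulrA.
Qed.

End Dotp.

(** * Second-order approximation of a level set by parabolas *)

Section LevelSet.
Variables (R : realType) (n : nat).
Notation V := 'rV[R]_(n.+1).
Implicit Types (p e g x v : V) (F : V -> R) (S U : set V).

Definition hess F x : 'M[R]_(n.+1) := \matrix_(j, i) pderiv j (pderiv i F) x.

Lemma parabola0 p e g c : parabola p e g c 0 = p.
Proof. by rewrite /parabola scale0r expr0n mulr0 scale0r !addr0. Qed.

Lemma continuous_parabola p e g :
  continuous (fun z : R * R => parabola p e g z.2 z.1).
Proof.
move=> z; apply: cvgD; [apply: cvgD; first exact: cvg_cst|].
  by apply: cvgZr_tmp; exact: cvg_fst.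
apply: cvgZr_tmp; apply: cvgM; first exact: cvg_snd.
by apply: cvgM; exact: cvg_fst.
Qed.

Lemma near_parabola U p e g c : open U -> U p ->
  \forall z \near ((0, c) : R * R), U (parabola p e g z.2 z.1).
Proof.
move=> oU Up; apply: (@continuous_parabola p e g (0, c)).
by rewrite parabola0; exact: open_nbhs_nbhs.
Qed.

Lemma near_parabola_along U p e g c : open U -> U p ->
  \forall s \near (0 : R), U (parabola p e g c s).
Proof.
move=> oU Up; have := near_parabola e g c oU Up => /nbhs_ballP [d /= d0 H].
apply/nbhs_ballP; exists d => //= s sd.
by apply: (H (s, c)); split => //=; exact: ballxx.
Qed.

(** The differentiated function is the derivative found in [is_derive_parabola], so this is the
    second derivative of [F] along the parabola: the Hessian on the velocity [e] plus the gradient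
    against the acceleration [2 * c *: g]. *)
Lemma is_derive2_parabola U F p e g c : open U -> U p -> smooth_on U F ->
  is_derive (0 : R) (1 : R)
    (fun s => \sum_i (e + (2 * c * s) *: g) 0 i * pderiv i F (parabola p e g c s))
    (quad (hess F p) e + 2 * c * dotp g (grad F p)).
Proof.
move=> oU Up sF.
have D (i : 'I_n.+1) : is_derive (0 : R) (1 : R)
    ((fun s : R => (e + (2 * c * s) *: g) 0 i) * (pderiv i F \o parabola p e g c))
    (e 0 i * (\sum_j e 0 j * hess F p j i) + 2 * c * (g 0 i * grad F p 0 i)).
  have D1 : is_derive (0 : R) (1 : R) (fun s : R => (e + (2 * c * s) *: g) 0 i)
      (2 * c * g 0 i).
    have -> : (fun s : R => (e + (2 * c * s) *: g) 0 i) =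
        cst (e 0 i) + (2 * c * g 0 i) *: (id : R -> R).
      apply/funext => s; rewrite !mxE; congr (_ + _).
      by rewrite -[RHS]/(2 * c * g 0 i * s); ring.
    apply: is_derive_eq (is_deriveD (is_derive_cst _ _ _)
      (is_deriveZ _ (is_derive_id _ _))) _.
    by rewrite add0r /GRing.scale /= mulr1.
  have D2 := @is_derive_parabola R n p e g c 0 (pderiv i F).
  rewrite parabola0 in D2; have {}D2 := D2 (sF [:: i] p Up).
  apply: is_derive_eq (is_deriveM D1 D2) _.
  rewrite /= parabola0 mulr0 scale0r addr0 /GRing.scale /= !mxE.
  congr (_ * _ + _); last by ring.
  by apply: eq_bigr => j _; rewrite !mxE.
have := is_derive_sum D.
set f := (X in is_derive _ _ X _); set f' := (X in is_derive _ _ _ X) => H.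
have -> : (fun s => \sum_i (e + (2 * c * s) *: g) 0 i *
    pderiv i F (parabola p e g c s)) = f.
  by apply/funext => s; rewrite /f fct_sumE.
apply: is_derive_eq H _; rewrite /f' big_split /= quadE; congr (_ + _).
  by apply: eq_bigr => i _; rewrite mulr_sumr; apply: eq_bigr => j _; rewrite mulrA.
by rewrite -mulr_sumr.
Qed.

(** For a tangent vector [e] the value and the first derivative of [F] along the parabola vanish at
    0, so the second derivative [d] decides the sign. *)
Lemma near_right_sign_parabola U F p e c :
  open U -> U p -> smooth_on U F -> F p = 0 -> dotp e (grad F p) = 0 ->
  let d := quad (hess F p) e + 2 * c * dotp (grad F p) (grad F p) in
  (0 < d -> \forall s \near (0 : R)^'+, 0 < F (parabola p e (grad F p) c s)) /\
  (d < 0 -> \forall s \near (0 : R)^'+, F (parabola p e (grad F p) c s) < 0).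
Proof.
move=> oU Up sF Fp eg; set g := grad F p in eg * => d.
have D1 : \forall s \near (0 : R), is_derive (s : R) (1 : R) (F \o parabola p e g c)
    (\sum_i (e + (2 * c * s) *: g) 0 i * pderiv i F (parabola p e g c s)).
  apply: filterS (near_parabola_along e g c oU Up) => s Us.
  exact: is_derive_parabola (sF [::] _ Us).
have D2 := is_derive2_parabola e g c oU Up sF.
have F0 : (F \o parabola p e g c) 0 = 0 by rewrite /= parabola0.
have F1 : \sum_i (e + (2 * c * 0) *: g) 0 i * pderiv i F (parabola p e g c 0) = 0.
  rewrite mulr0 scale0r addr0 parabola0 -[RHS]eg.
  by apply: eq_bigr => i _; rewrite mxE.
split=> Hd.
  exact: near_right_pos_of_derive2_gt0 D1 F0 F1 D2 Hd.
exact: near_right_neg_of_derive2_lt0 D1 F0 F1 D2 Hd.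
Qed.

(* For fixed small [s] the defining function changes sign as the coefficient of
   the quadratic term crosses the value prescribed by the Hessian, so the
   intermediate value theorem yields a point of the hypersurface. *)
Lemma level_set_parabola S U F p e (eps : R) :
  open U -> U p -> S p -> smooth_on U F -> grad F p != 0 ->
  (forall x, U x -> (S x <-> F x = 0)) -> dotp e (grad F p) = 0 -> 0 < eps ->
  \forall s \near (0 : R)^'+, exists k,
    `|k + quad (hess F p) e / (2 * dotp (grad F p) (grad F p))| < eps /\
    S (parabola p e (grad F p) k s).
Proof.
move=> oU Up Sp sF g0 SF eg eps0.
have Fp : F p = 0 by apply/SF.
move: g0; rewrite -dotp_gt0; set g := grad F p in eg * => gg0.
(* At the coefficient [- kap] the second derivative along the parabola is 0; at [- kap - r] and
   [- kap + r] it is [-2 * r * dotp g g] and [2 * r * dotp g g], whence the change of sign. *)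
set kap := quad (hess F p) e / (2 * dotp g g).
have /nbhs_ballP [d /= d0 Ud] := near_parabola e g (- kap) oU Up.
(* Halving makes [r] strictly smaller than both [eps], the required precision, and [d], which keeps
   the parabolas inside [U]. *)
pose r := Num.min eps d / 2.
have r0 : 0 < r by rewrite divr_gt0 // lt_min eps0.
have [re rd] : r < eps /\ r < d.
  have : Num.min eps d / 2 < Num.min eps d.
    by rewrite ltr_pdivrMr // ltr_pMr ?ltr1n // lt_min eps0.
  by rewrite lt_min => /andP[].
have kapE : quad (hess F p) e = 2 * kap * dotp g g.
  by rewrite /kap; field; rewrite gt_eqF.
have [+ _] := near_right_sign_parabola (- kap + r) oU Up sF Fp eg.
have [_ +] := near_right_sign_parabola (- kap - r) oU Up sF Fp eg.
rewrite -/g kapE => Hm Hp.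
have {}Hm : \forall s \near (0 : R)^'+, F (parabola p e g (- kap - r) s) < 0.
  by apply: Hm; nra.
have {}Hp : \forall s \near (0 : R)^'+, 0 < F (parabola p e g (- kap + r) s).
  by apply: Hp; nra.
near=> s.
have s0 : 0 < s by [].
have sd : s < d by near: s; exact: nbhs_right_lt.
have Fm : F (parabola p e g (- kap - r) s) < 0 by near: s.
have Fpos : 0 < F (parabola p e g (- kap + r) s) by near: s.
have inU k : k \in `[(- kap - r), (- kap + r)] -> U (parabola p e g k s).
  rewrite in_itv /= => /andP[k1 k2]; apply: (Ud (s, k)); split => /=.
    by rewrite /ball /= sub0r normrN gtr0_norm.
  by rewrite /ball /= ltr_norml; apply/andP; split; lra.
have [|||k kI Fk] := @IVT R (fun k => F (parabola p e g k s))
    (- kap - r) (- kap + r) 0.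
- lra.
- apply: continuous_in_subspaceT => k kI.
  apply: (@continuous_comp _ _ _ (fun k => parabola p e g k s) F).
    rewrite /parabola; apply: cvgD; first exact: cvg_cst.
    by apply: cvgZr_tmp; apply: cvgM; [exact: cvg_id|exact: cvg_cst].
  apply: differentiable_continuous; apply: (sF [::]); apply: inU.
  by move: kI; rewrite inE.
- by rewrite ge_min le_max (ltW Fm) (ltW Fpos) orbT.
exists k; split; last by apply/SF => //; exact: inU.
move: kI; rewrite in_itv /= => /andP[k1 k2].
by rewrite ltr_norml; apply/andP; split; lra.
Unshelve. all: by end_near. Qed.

End LevelSet.

(** * Mean curvature of a level set and the shrinker equation *)

Lemma is_derive_inv_sqrt (R : realType) (t : R) : 0 < t ->
  is_derive t (1 : R) (fun x => (Num.sqrt x)^-1) (- (2 * t * Num.sqrt t)^-1).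
Proof.
move=> t0; have [d1 d2] := is_derive1_sqrt t0.
have st0 : Num.sqrt t != 0 by rewrite gt_eqF // sqrtr_gt0.
apply: DeriveDef; first exact: derivableV.
rewrite deriveV // d2 /GRing.scale /= sqr_sqrtr ?ltW //.
by field; rewrite st0 gt_eqF.
Qed.

Section Shrinker.
Variables (R : realType) (n : nat).
Notation V := 'rV[R]_(n.+1).
Implicit Types (p e g x v : V) (F : V -> R) (S U : set V) (M : 'M[R]_(n.+1)).

Lemma derive_sqnorm_grad U F p v : U p -> smooth_on U F ->
  differentiable (fun y => dotp (grad F y) (grad F y)) p /\
  'D_v (fun y => dotp (grad F y) (grad F y)) p =
    2 * \sum_j pderiv j F p * 'D_v (pderiv j F) p.
Proof.
move=> Up sF.
have -> : (fun y => dotp (grad F y) (grad F y)) =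
    \sum_j (pderiv j F * pderiv j F).
  apply/funext => y; rewrite fct_sumE; apply: eq_bigr => j _.
  by rewrite !mxE.
have dF j : differentiable (pderiv j F) p := sF [:: j] p Up.
split; first by apply: differentiable_sum => j; exact: differentiableM.
have dv j : derivable (pderiv j F) p v by exact: diff_derivable.
rewrite derive_sum; last by move=> j; exact: derivableM.
rewrite mulr_sumr; apply: eq_bigr => j _.
by rewrite deriveM // /GRing.scale /=; ring.
Qed.

(** Product rule for [N^(-1/2)] times a partial derivative of [F], where [N] is the squared length
    of the gradient. The bracket is the trace of the Hessian on the tangent space. *)
Lemma divergence_unit_normal U F p : U p -> smooth_on U F -> grad F p != 0 ->
  divergence (unit_normal F) p = (enorm (grad F p))^-1 *
    (\tr (hess F p) - quad (hess F p) (grad F p) / dotp (grad F p) (grad F p)).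
Proof.
move=> Up sF; rewrite -dotp_gt0 /enorm => N0.
set N := dotp _ _ in N0 *; set rt : R := Num.sqrt N.
have rt0 : rt != 0 by rewrite gt_eqF // sqrtr_gt0.
have dF j : differentiable (pderiv j F) p := sF [:: j] p Up.
have E (i : 'I_n.+1) : pderiv i (fun y => unit_normal F y 0 i) p =
    rt^-1 * hess F p i i -
    (rt * N)^-1 * \sum_j grad F p 0 i * grad F p 0 j * hess F p i j.
  have -> : (fun y => unit_normal F y 0 i) =
      ((fun t : R => (Num.sqrt t)^-1) \o (fun y => dotp (grad F y) (grad F y)))
      * pderiv i F.
    by apply/funext => y; rewrite !mxE.
  have [dN vN] := derive_sqnorm_grad (evec R i) Up sF.
  have [dc vc] := derive_comp_real (evec R i) dN (is_derive_inv_sqrt N0).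
  rewrite [LHS]deriveM; [|exact: dc|exact: diff_derivable].
  rewrite vc vN /= -/N -/rt /GRing.scale /= [hess F p i i]mxE; congr (_ + _).
  have -> : \sum_j grad F p 0 i * grad F p 0 j * hess F p i j =
      pderiv i F p * \sum_j pderiv j F p * 'D_(evec R i) (pderiv j F) p.
    rewrite mulr_sumr; apply: eq_bigr => j _.
    by rewrite !mxE mulrA.
  rewrite /pderiv; field.
  by rewrite rt0 gt_eqF.
rewrite /divergence (eq_bigr _ (fun i _ => E i)) sumrB -!mulr_sumr.
rewrite mulrBr; congr (_ - _).
rewrite quadE exchange_big /= invfM mulrAC -mulrA; congr (_ * (_ * _)).
by apply: eq_bigr => i _; apply: eq_bigr => j _; congr (_ * _); rewrite mulrC.
Qed.

(** Both sides of the shrinker equation are multiples of the nonzero unit normal; comparing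
    coefficients and cancelling the length of the gradient leaves a scalar identity. *)
Lemma shrinker_trace_hess U F p : U p -> smooth_on U F -> grad F p != 0 ->
  mean_curv_vec F p = - (2^-1) *: normal_part F p ->
  \tr (hess F p) - quad (hess F p) (grad F p) / dotp (grad F p) (grad F p) =
  2^-1 * dotp p (grad F p).
Proof.
move=> Up sF g0; rewrite /mean_curv_vec /normal_part.
rewrite (divergence_unit_normal Up sF g0).
have r0 : enorm (grad F p) != 0 by rewrite gt_eqF // sqrtr_gt0 dotp_gt0.
have nu0 : unit_normal F p != 0 by rewrite scaler_eq0 invr_eq0 negb_or r0.
have nuE : dotp p (unit_normal F p) = (enorm (grad F p))^-1 * dotp p (grad F p).
  by rewrite dotpZr.
move: (unit_normal F p) nu0 nuE => nu nu0 ->; rewrite scalerA => /eqP.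
rewrite -subr_eq0 -scalerBl scaler_eq0 (negPf nu0) orbF subr_eq0 => /eqP H.
apply: (mulfI (invr_neq0 r0)); lra.
Qed.

(* Second-order description of a shrinker at [p]: a normal vector [g] and a
   matrix [M] (gradient and Hessian of a defining function) determining the
   acceleration of curves, whose trace on the tangent space is prescribed. *)
Definition shrinker_jet S p g M : Prop :=
  [/\ g != 0,
      \tr M - quad M g / dotp g g = 2^-1 * dotp p g &
      forall e (eps : R), dotp e g = 0 -> 0 < eps ->
        \forall s \near (0 : R)^'+, exists k,
          `|k + quad M e / (2 * dotp g g)| < eps /\ S (parabola p e g k s)].

Lemma shrinker_jetP S p : shrinker S -> S p -> exists g M, shrinker_jet S p g M.
Proof.
move=> [_ _ /(_ p) HS] Sp.
have [U [F [oU Up sF gF [SF HF]]]] := HS Sp.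
exists (grad F p), (hess F p); split; first exact: gF.
  exact: shrinker_trace_hess Up sF (gF p Up) (HF p Up Sp).
by move=> e eps eg eps0; exact: level_set_parabola oU Up Sp sF (gF p Up) SF eg eps0.
Qed.

End Shrinker.

(** * First and second variation from jets *)

Section Variation.
Variables (R : realType) (n : nat).
Notation V := 'rV[R]_(n.+1).
Implicit Types (p q e g x v w : V) (S U : set V) (M : 'M[R]_(n.+1)).

(** A jet concerns only points near [p], so it survives the restriction to the open ball, where the
    maximality used later is available. *)
Lemma shrinker_jet_setI S U p g M : open U -> U p ->
  shrinker_jet S p g M -> shrinker_jet (S `&` U) p g M.
Proof.
move=> oU Up [g0 trM H]; split=> // e eps eg eps0.
have /nbhs_ballP [d /= d0 Ud] :=
  near_parabola e g (- (quad M e / (2 * dotp g g))) oU Up.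
have eps1 : 0 < Num.min eps d by rewrite lt_min eps0.
near=> s.
have sd : s < d by near: s; exact: nbhs_right_lt.
have [k [+ Sk]] : exists k, `|k + quad M e / (2 * dotp g g)| < Num.min eps d /\
    S (parabola p e g k s) by near: s; exact: H.
rewrite lt_min => /andP[k1 k2]; exists k; split=> //; split=> //.
apply: (Ud (s, k)); split => /=.
  by rewrite /ball /= sub0r normrN gtr0_norm.
by rewrite /ball /= distrC opprK.
Unshelve. all: by end_near. Qed.

Lemma le0_of_approx (Q : R * (R * R) -> R) (k0 l0 : R) :
  {for (0, (k0, l0)), continuous Q} ->
  (forall eps, 0 < eps -> exists s k l,
    [/\ 0 < s < eps, `|k - k0| < eps, `|l - l0| < eps & Q (s, (k, l)) <= 0]) ->
  Q (0, (k0, l0)) <= 0.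
Proof.
move=> cQ H; rewrite leNgt; apply/negP => Q0.
move: cQ => /cvgr_gt /(_ 0 Q0) /nbhs_ballP [d /= d0 Hd].
have [s [k [l [/andP[s0 sd] kd ld]]]] := H d d0.
apply/negP; rewrite -ltNge; apply: (Hd (s, (k, l))).
split; first by rewrite /ball /= sub0r normrN gtr0_norm.
by split; rewrite /ball /= distrC.
Qed.

(** Divide by [s], or by [s ^+ 2] when [a = 0], and let [s] tend to 0 along the points supplied by
    the jets: [k] and [l] tend to the coefficients prescribed by [M0] and [M1]. *)
Lemma jet_variation S0 S1 p q g0 g1 M0 M1 e0 e1 (a : R) (Q : R * (R * R) -> R) :
  shrinker_jet S0 p g0 M0 -> shrinker_jet S1 q g1 M1 ->
  dotp e0 g0 = 0 -> dotp e1 g1 = 0 -> continuous Q ->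
  (forall s k l, S0 (parabola p e0 g0 k s) -> S1 (parabola q e1 g1 l s) ->
    s * a + s ^+ 2 * Q (s, (k, l)) <= 0) ->
  a <= 0 /\ (a = 0 -> Q (0, (- (quad M0 e0 / (2 * dotp g0 g0)),
                             - (quad M1 e1 / (2 * dotp g1 g1)))) <= 0).
Proof.
move=> [_ _ J0] [_ _ J1] eg0 eg1 cQ H.
set k0 := - (quad M0 _ / _); set l0 := - (quad M1 _ / _).
have {}H eps : 0 < eps -> exists s k l, [/\ 0 < s < eps, `|k - k0| < eps,
    `|l - l0| < eps & s * a + s ^+ 2 * Q (s, (k, l)) <= 0].
  move=> eps0; near (0 : R)^'+ => s; exists s.
  have s0 : 0 < s by [].
  have [k [k1 Sk]] : exists k, `|k + quad M0 e0 / (2 * dotp g0 g0)| < eps /\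
    S0 (parabola p e0 g0 k s) by near: s; exact: J0.
  have [l [l1 Sl]] : exists l, `|l + quad M1 e1 / (2 * dotp g1 g1)| < eps /\
    S1 (parabola q e1 g1 l s) by near: s; exact: J1.
  exists k, l; split; rewrite ?opprK //; last exact: H.
  by apply/andP; split => //; near: s; exact: nbhs_right_lt.
have Ha : a <= 0.
  pose Q1 z := a + z.1 * Q z.
  have -> : a = Q1 (0, (k0, l0)) by rewrite /Q1 /= mul0r addr0.
  apply: le0_of_approx.
    apply: cvgD; first exact: cvg_cst.
    by apply: cvgM; [exact: cvg_fst|exact: cQ].
  move=> eps /H[s [k [l [/andP[s0 se] k1 l1 Hs]]]].
  exists s, k, l; split; rewrite ?s0 //.
  rewrite -(pmulr_rle0 _ s0); apply: le_trans Hs.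
  by rewrite /Q1 /= le_eqVlt; apply/orP; left; apply/eqP; ring.
split=> // a0; apply: le0_of_approx; first exact: cQ.
move=> eps /H[s [k [l [/andP[s0 se] k1 l1 Hs]]]].
exists s, k, l; split; rewrite ?s0 //.
by move: Hs; rewrite a0 mulr0 add0r pmulr_rle0 // exprn_gt0.
Unshelve. all: by end_near. Qed.

End Variation.

(** * Traces on tangent spaces and reflections *)

Section TangentTrace.
Variables (R : realType) (n : nat).
Notation V := 'rV[R]_(n.+1).
Implicit Types (g v w : V) (M : 'M[R]_(n.+1)).

Lemma quadZ M a v : quad M (a *: v) = a ^+ 2 * quad M v.
Proof.
rewrite /quad -scalemxAl -scalemxAl [(_ *: v)^T]linearZ /= -scalemxAr !mxE.
by rewrite expr2 mulrA.
Qed.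

Lemma quad1 v : quad 1%:M v = dotp v v.
Proof. by rewrite /quad mulmx1 dotpE. Qed.

(** The rows are the projections of the standard basis to the hyperplane orthogonal to [g]. They
    form a Parseval frame of it, which replaces the choice of an orthonormal basis. *)
Definition proj_orth g : 'M[R]_(n.+1) := 1%:M - (dotp g g)^-1 *: (g^T *m g).

Lemma mul_row_dotp v w : v *m w^T = (dotp v w)%:M.
Proof. by rewrite [LHS]mx11_scalar dotpE. Qed.

Lemma dotp_row_proj_orth g i : g != 0 -> dotp (row i (proj_orth g)) g = 0.
Proof.
rewrite -dotp_gt0 => g0; rewrite dotpE -row_mul /proj_orth mulmxBl mul1mx.
rewrite -scalemxAl -mulmxA mul_row_dotp mul_mx_scalar scalerA mulVf ?gt_eqF //.
by rewrite scale1r subrr !mxE.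
Qed.

(** The sum is the trace of [P *m M *m P^T], which equals that of [P *m M] since [P] is a symmetric
    idempotent. *)
Lemma sum_quad_proj_orth M g : g != 0 ->
  \sum_i quad M (row i (proj_orth g)) = \tr M - quad M g / dotp g g.
Proof.
rewrite -dotp_gt0 => g0; set P := proj_orth g.
have PT : P^T = P.
  by rewrite /P /proj_orth linearB /= trmx1 linearZ /= trmx_mul trmxK.
have PP : P *m P = P.
  rewrite {1}/P /proj_orth mulmxBl mul1mx -scalemxAl -mulmxA.
  have -> : g *m P = 0.
    rewrite /P /proj_orth mulmxBr mulmx1 -scalemxAr mulmxA mul_row_dotp.
    by rewrite mul_scalar_mx scalerA mulVf ?gt_eqF // scale1r subrr.
  by rewrite mulmx0 scaler0 subr0.
transitivity (\tr (P *m M *m P^T)).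
  apply: eq_bigr => i _.
  rewrite /quad tr_row -row_mul [LHS]mxE [RHS]mxE.
  by apply: eq_bigr => j _; rewrite mxE [in X in _ * X]mxE.
rewrite mxtrace_mulC mulmxA PT PP /P /proj_orth mulmxBl mul1mx linearB /=.
rewrite -scalemxAl linearZ /= -mulmxA mxtrace_mulC; congr (_ - _).
by rewrite trace_mx11 mulrC.
Qed.

Definition reflection w : 'M[R]_(n.+1) := 1%:M - (2 / dotp w w) *: (w^T *m w).

Lemma mul_reflection v w : v *m reflection w = v - (2 / dotp w w * dotp v w) *: w.
Proof.
by rewrite mulmxBr mulmx1 -scalemxAr mulmxA mul_row_dotp mul_scalar_mx scalerA.
Qed.

Lemma trmx_reflection w : (reflection w)^T = reflection w.
Proof. by rewrite linearB /= trmx1 linearZ /= trmx_mul trmxK. Qed.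

Lemma reflectionK w : w != 0 -> reflection w *m reflection w = 1%:M.
Proof.
rewrite -dotp_gt0 => w0; apply/row_matrixP => i.
rewrite row_mul mul_reflection row1 rowE mul_reflection !dotp_linear.
set d := dotp (delta_mx 0 i) w; set W := dotp w w in w0 *.
rewrite -addrA -opprD -scalerDl.
have -> : 2 / W * d + 2 / W * (d - 2 / W * d * W) = 0.
  by field; rewrite gt_eqF.
by rewrite scale0r subr0.
Qed.

Lemma quad_reflection M v w :
  quad M (v *m reflection w) = quad (reflection w *m M *m reflection w) v.
Proof. by rewrite /quad trmx_mul trmx_reflection !mulmxA. Qed.

Lemma dotp_reflection u v w : w != 0 ->
  dotp (u *m reflection w) (v *m reflection w) = dotp u v.
Proof.
move=> w0; rewrite !dotpE trmx_mul trmx_reflection mulmxA -(mulmxA u).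
by rewrite reflectionK // mulmx1.
Qed.

(** The reflection maps the complement of [g] isometrically onto that of [h], so the reflected frame
    still computes a trace; the scale [c] drops out. *)
Lemma sum_quad_reflection_proj_orth M g h w (c : R) : g != 0 -> w != 0 ->
  g *m reflection w = c *: h ->
  \sum_i quad M (row i (proj_orth g) *m reflection w) =
  \tr M - quad M h / dotp h h.
Proof.
move=> g0 w0 gh.
under eq_bigr do rewrite quad_reflection.
rewrite sum_quad_proj_orth // -quad_reflection.
rewrite -(dotp_reflection g g w0) gh mxtrace_mulC mulmxA reflectionK // mul1mx.
rewrite quadZ !dotp_linear.
have ch0 : c *: h != 0.
  by rewrite -gh -dotp_gt0 dotp_reflection // dotp_gt0.
move: ch0; rewrite scaler_eq0 negb_or => /andP[c0]; rewrite -dotp_gt0 => h0.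
by congr (_ - _); field; rewrite c0 gt_eqF.
Qed.

Lemma sum_dotp_proj_orth g : g != 0 ->
  \sum_i dotp (row i (proj_orth g)) (row i (proj_orth g)) = n%:R.
Proof.
move=> g0; under eq_bigr do rewrite -quad1.
rewrite sum_quad_proj_orth // quad1 divff ?dotp_eq0 // mxtrace1.
by rewrite -natr1 addrK.
Qed.

(** Test the hypothesis on the component [e] of [v] orthogonal to [g]: there [dotp v e] is the
    squared length of [e]. *)
Lemma parallel_of_orth v g : g != 0 ->
  (forall e, dotp e g = 0 -> dotp v e <= 0) -> v = (dotp v g / dotp g g) *: g.
Proof.
rewrite -dotp_gt0 => g0 H; apply/eqP; rewrite -subr_eq0 -dotp_eq0.
set c := _ / _; set e := v - _.
have eg : dotp e g = 0.
  by rewrite /e !dotp_linear /c; field; rewrite gt_eqF.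
have ee : dotp e e = dotp v e.
  by rewrite {1}/e dotpDl dotpNl dotpZl (dotpC g) eg mulr0 subr0.
by rewrite eq_le dotp_ge0 andbT ee H.
Qed.

End TangentTrace.

(** * Compactness, Taylor remainders and the point closest to the origin *)

Section Frankel.
Variables (R : realType) (n : nat).
Notation V := 'rV[R]_(n.+1).
Implicit Types (p q e g x y v w : V) (S : set V) (M : 'M[R]_(n.+1)).

Lemma cvg_dotp (T : Type) (F : set_system T) {FF : Filter F} (f g : T -> V) (a b : V) :
  f @ F --> a -> g @ F --> b -> dotp (f t) (g t) @[t --> F] --> dotp a b.
Proof.
move=> fa gb; apply: cvg_big => [|i _]; first exact: add_continuous.
apply: cvgM.
  exact: (@cvg_comp _ _ _ f (fun v : V => v 0 i) _ _ _ fa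
    (@coord_continuous R 1 n.+1 0 i a)).
exact: (@cvg_comp _ _ _ g (fun v : V => v 0 i) _ _ _ gb
  (@coord_continuous R 1 n.+1 0 i b)).
Qed.

Lemma continuous_sqnorm : continuous (fun x : V => dotp x x).
Proof.
move=> x.
exact: (@cvg_dotp V (nbhs x) _ id id x x (@cvg_id _ _) (@cvg_id _ _)).
Qed.

Lemma compact_closed_sqnorm_le S (r : R) : closed S ->
  compact (S `&` [set x | dotp x x <= r]).
Proof.
move=> cS; apply: bounded_closed_compact; last first.
  apply: closedI => //.
  apply: (@closed_comp _ _ (fun x : V => dotp x x) [set t | t <= r]).
    by move=> x _; exact: continuous_sqnorm.
  exact: closed_le.
(* Every coordinate has square at most [r], hence below [(1 + r) ^+ 2]. *)
exists (1 + r); split; first exact: num_real.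
move=> m rm x [_ /= xr]; rewrite [leLHS]mx_normrE.
have r0 : 0 <= r := le_trans (dotp_ge0 x) xr.
apply/bigmax_leP; split=> [|[i j] _ /=]; first lra.
rewrite (ord1 i); have xj : x 0 j * x 0 j <= dotp x x.
  rewrite /dotp (bigD1 j) //= lerDl; apply: sumr_ge0 => k _.
  by rewrite -expr2 sqr_ge0.
by rewrite ler_norml; apply/andP; split; nra.
Qed.

(* [square_rem] and [distance_rem] are the second-order Taylor remainders of
   [|x|^2] and [|x - y|^2] along parabolas with parameter [s] and quadratic
   coefficients [k], [l]. *)
Definition square_rem (a b c s k : R) : R := a + 2 * b * k + c * (s * s * (k * k)).

Definition distance_rem (a b b' c c' d d' f s k l : R) : R :=
  a + 2 * b * k - 2 * b' * l + s * (2 * c * k - 2 * c' * l)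
  + s * s * (d * (k * k) - 2 * f * (k * l) + d' * (l * l)).

Lemma sqnorm_parabola p e g (k s : R) : dotp e g = 0 ->
  dotp (parabola p e g k s) (parabola p e g k s) =
  dotp p p + s * (2 * dotp p e) +
  s ^+ 2 * square_rem (dotp e e) (dotp p g) (dotp g g) s k.
Proof.
move=> eg; rewrite /parabola /square_rem !dotp_linear.
rewrite (dotpC g e) (dotpC g p) (dotpC e p) eg; ring.
Qed.

Lemma sqdist_parabola p q e e' g g' (k l s : R) :
  let x := parabola p e g k s in let y := parabola q e' g' l s in
  dotp (x - y) (x - y) = dotp (p - q) (p - q) + s * (2 * dotp (p - q) (e - e')) +
  s ^+ 2 * distance_rem (dotp (e - e') (e - e')) (dotp (p - q) g) (dotp (p - q) g')
    (dotp (e - e') g) (dotp (e - e') g') (dotp g g) (dotp g' g') (dotp g g') s k l.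
Proof.
move=> x y.
have -> : x - y = (p - q) + s *: (e - e') + (k * s ^+ 2) *: g - (l * s ^+ 2) *: g'.
  by apply/rowP => i; rewrite !mxE; ring.
move: (p - q) (e - e') => w d; rewrite /distance_rem !dotp_linear.
rewrite (dotpC g w) (dotpC d w) (dotpC g d) (dotpC g' w) (dotpC g' d) (dotpC g' g).
ring.
Qed.

Lemma continuous_snd_fst : continuous (fun z : R * (R * R) => z.2.1).
Proof. by move=> z; apply: cvg_comp; [exact: cvg_snd|exact: cvg_fst]. Qed.

Lemma continuous_snd_snd : continuous (fun z : R * (R * R) => z.2.2).
Proof. by move=> z; apply: cvg_comp; [exact: cvg_snd|exact: cvg_snd]. Qed.

Lemma continuous_square_rem a b c :
  continuous (fun z : R * (R * R) => square_rem a b c z.1 z.2.1) /\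
  continuous (fun z : R * (R * R) => square_rem a b c z.1 z.2.2).
Proof.
have H (h : R * (R * R) -> R) :
    continuous h -> continuous (fun z => square_rem a b c z.1 (h z)).
  move=> ch z.
  rewrite /square_rem; apply: cvgD; first apply: cvgD; first exact: cvg_cst.
    by apply: cvgM; [exact: cvg_cst|exact: ch].
  apply: cvgM; first exact: cvg_cst.
  apply: cvgM; first by apply: cvgM; exact: cvg_fst.
  by apply: cvgM; exact: ch.
by split; apply: H; [exact: continuous_snd_fst|exact: continuous_snd_snd].
Qed.

Lemma continuous_distance_rem a b b' c c' d d' f : continuous
  (fun z : R * (R * R) => distance_rem a b b' c c' d d' f z.1 z.2.1 z.2.2).
Proof.
move=> z; rewrite /distance_rem.
have s : (fun z : R * (R * R) => z.1) @ z --> z.1 by exact: cvg_fst.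
have k := @continuous_snd_fst z; have l := @continuous_snd_snd z.
have cM (h : R * (R * R) -> R) (e x : R) : h @ z --> x -> e * h y @[y --> z] --> e * x.
  by move=> H; apply: cvgM => //; exact: cvg_cst.
apply: cvgD; first apply: cvgD.
- by apply: cvgB; [apply: cvgD; [exact: cvg_cst|exact: cM]|exact: cM].
- by apply: cvgM => //; apply: cvgB; exact: cM.
- apply: cvgM; first exact: cvgM.
  apply: cvgD; last by apply: cM; exact: cvgM.
  by apply: cvgB; apply: cM; exact: cvgM.
Qed.

Lemma shrinker_near_origin S : shrinker S -> exists p, S p /\ dotp p p <= 2 * n%:R.
Proof.
move=> shS; have [[x0 Sx0] cS _] := shS.
have [|p] := compact_EVT_min _ (compact_closed_sqnorm_le (r := dotp x0 x0) cS)
  (continuous_subspaceT continuous_sqnorm).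
  by exists x0; split => /=.
rewrite inE => -[Sp pmin0] pmin1.
have pmin x : S x -> dotp p p <= dotp x x.
  move=> Sx; have [xx0|/ltW] := leP (dotp x x) (dotp x0 x0).
    by apply: pmin1; rewrite inE.
  exact: le_trans.
exists p; split => //.
have [g [M J]] := shrinker_jetP shS Sp; have [g0 trM _] := J.
(* The same jet serves twice: the second point has velocity 0 and [Q] ignores it. The signs are
   reversed because [p] is a minimum. *)
have V1 e (eg : dotp e g = 0) := jet_variation (a := - (2 * dotp p e))
  (Q := fun z => - square_rem (dotp e e) (dotp p g) (dotp g g) z.1 z.2.1)
  J J eg (dotp0l g).
have {}V1 e : dotp e g = 0 -> - (2 * dotp p e) <= 0 /\ (- (2 * dotp p e) = 0 ->
    - (dotp e e - quad M e / dotp g g * dotp p g) <= 0).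
  move=> eg; have [||H1 H2] := V1 e eg.
  - by move=> z; apply: cvgN; exact: (continuous_square_rem _ _ _).1.
  - move=> s k l /pmin + _; rewrite sqnorm_parabola //= => H.
    by move: (square_rem _ _ _ _ _) H => r; lra.
  split=> // /H2; rewrite /square_rem /= !mul0r mulr0 addr0.
  set c := (X in X <= 0 -> _); set c' := (X in _ -> X <= 0).
  suff -> : c = c' by [].
  by rewrite /c /c'; field; rewrite gt_eqF // dotp_gt0.
have pe e : dotp e g = 0 -> dotp p e = 0.
  move=> eg; have [H1 _] := V1 e eg.
  have [|H2 _] := V1 (- e); first by rewrite dotpNl eg oppr0.
  by move: H2; rewrite dotpNr; lra.
have pg : p = (dotp p g / dotp g g) *: g.
  by apply: parallel_of_orth => // e /pe ->.
(* Summed over the frame, the second variation gives [n - dotp p p / 2 >= 0], because [p] is normal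
   to the hypersurface. *)
have : \sum_i - (dotp (row i (proj_orth g)) (row i (proj_orth g)) -
    quad M (row i (proj_orth g)) / dotp g g * dotp p g) <= 0.
  apply: sumr_le0 => i _; have eg := dotp_row_proj_orth i g0.
  by have [_] := V1 _ eg; apply; rewrite pe // mulr0 oppr0.
rewrite sumrN sumrB sum_dotp_proj_orth // -!mulr_suml sum_quad_proj_orth // trM.
have -> : 2^-1 * dotp p g / dotp g g * dotp p g = dotp p p / 2.
  rewrite [in RHS]pg !dotp_linear; field; rewrite gt_eqF //= dotp_gt0 //.
lra.
Qed.

(** * The two-point maximum in the open ball *)

Definition ball_weight x : R := 4 * n%:R - dotp x x.

Local Notation u := ball_weight.

Section Maximiser.
Variables (S0 S1 : set V) (p q g0 g1 : V) (M0 M1 : 'M[R]_(n.+1)) (m : R).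
Hypotheses (J0 : shrinker_jet S0 p g0 M0) (J1 : shrinker_jet S1 q g1 M1).
Hypothesis le_m : forall x y, S0 x -> S1 y -> u x * u y <= m * dotp (x - y) (x - y).
Hypothesis eq_m : u p * u q = m * dotp (p - q) (p - q).
Hypotheses (up_gt0 : 0 < u p) (uq_gt0 : 0 < u q) (pq : p - q != 0).

Let w := p - q.
Let W := dotp w w.
(** [-2 *: A] and [-2 *: B] are the gradients of [u x * u y - m * dotp (x - y) (x - y)] in [x] and
    in [y] at [(p, q)]. *)
Let A := u q *: p + m *: w.
Let B := u p *: q - m *: w.

Let W_gt0 : 0 < W. Proof. by rewrite dotp_gt0. Qed.

Let m_gt0 : 0 < m.
Proof. by rewrite -(pmulr_lgt0 _ W_gt0) -eq_m mulr_gt0. Qed.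

Let dotpA v : dotp A v = u q * dotp p v + m * dotp w v.
Proof. by rewrite dotpDl !dotpZl. Qed.

Let dotpB v : dotp B v = u p * dotp q v - m * dotp w v.
Proof. by rewrite dotpDl dotpNl !dotpZl. Qed.

Lemma maximiser_variation e e' : dotp e g0 = 0 -> dotp e' g1 = 0 ->
  - 2 * (dotp A e + dotp B e') <= 0 /\
  (dotp A e + dotp B e' = 0 ->
   - (u p * dotp e' e' + u q * dotp e e) + 4 * dotp p e * dotp q e'
   - m * dotp (e - e') (e - e')
   + quad M0 e / dotp g0 g0 * dotp A g0 + quad M1 e' / dotp g1 g1 * dotp B g1 <= 0).
Proof.
move=> eg0 eg1.
have [g0n0 _ _] := J0; have [g1n0 _ _] := J1.
(* Here [X], [Y], [D] are the remainders of the two squared norms and of the squared distance; [Q]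
   collects all terms of order two and higher in the product of the two weights minus [m] times the
   squared distance. *)
have [| |V1 V2] := jet_variation (a := - 2 * (dotp A e + dotp B e'))
  (Q := fun z : R * (R * R) =>
    let X := square_rem (dotp e e) (dotp p g0) (dotp g0 g0) z.1 z.2.1 in
    let Y := square_rem (dotp e' e') (dotp q g1) (dotp g1 g1) z.1 z.2.2 in
    let D := distance_rem (dotp (e - e') (e - e')) (dotp w g0) (dotp w g1)
      (dotp (e - e') g0) (dotp (e - e') g1) (dotp g0 g0) (dotp g1 g1) (dotp g0 g1)
      z.1 z.2.1 z.2.2 in
    4 * dotp p e * dotp q e' - (u p * Y + u q * X)
    + z.1 * (2 * dotp p e * Y + 2 * dotp q e' * X) + z.1 * z.1 * (X * Y) - m * D)
  J0 J1 eg0 eg1.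
- move=> z /=.
  have cX := (continuous_square_rem (dotp e e) (dotp p g0) (dotp g0 g0)).1 z.
  have cY := (continuous_square_rem (dotp e' e') (dotp q g1) (dotp g1 g1)).2 z.
  have s : (fun z : R * (R * R) => z.1) @ z --> z.1 by exact: cvg_fst.
  have cM (h : R * (R * R) -> R) (c x : R) :
      h @ z --> x -> c * h y @[y --> z] --> c * x.
    by move=> H; apply: cvgM => //; exact: cvg_cst.
  apply: cvgB; last by apply: cM; exact: continuous_distance_rem.
  apply: cvgD; last by apply: cvgM; exact: cvgM.
  apply: cvgD; last by apply: cvgM => //; apply: cvgD; exact: cM.
  by apply: cvgB; [exact: cvg_cst|apply: cvgD; exact: cM].
- move=> s k l Sx Sy; have := le_m Sx Sy; rewrite -subr_le0; apply: le_trans.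
  rewrite le_eqVlt; apply/orP; left; apply/eqP => /=.
  rewrite sqdist_parabola -/w {3 4}/ball_weight !sqnorm_parabola //.
  move: (square_rem _ _ _ _ _) (square_rem _ _ _ _ _)
    (distance_rem _ _ _ _ _ _ _ _ _ _ _) => X Y D.
  rewrite !dotpA !dotpB dotpDr dotpNr.
  have E3 : u p * u q = m * dotp w w := eq_m.
  move: E3; rewrite /ball_weight => E3; lra.
split=> // H; move: V2; rewrite H mulr0 => /(_ erefl).
rewrite /square_rem /distance_rem /=.
set d := (X in X <= 0 -> _); set d' := (X in _ -> X <= 0).
suff -> : d = d' by [].
rewrite /d /d' !dotpA !dotpB.
by field; rewrite !gt_eqF ?dotp_gt0.
Qed.


Let dotp_pw : dotp p w = (u q - u p + W) / 2.
Proof. rewrite /W /w /ball_weight !dotp_linear (dotpC q p); lra. Qed.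

Let dotp_qw : dotp q w = (u q - u p - W) / 2.
Proof. rewrite /W /w /ball_weight !dotp_linear (dotpC q p); lra. Qed.

Let m_def : m = u p * u q / W.
Proof. by rewrite eq_m mulfK // gt_eqF. Qed.

Let dotp_AA : dotp A A = u q ^+ 2 * (4 * n%:R + m).
Proof.
rewrite dotpA (dotpC p A) (dotpC w A) !dotpA (dotpC w p) dotp_pw -/W m_def.
rewrite -[dotp p p](subKr (4 * n%:R)) -[4 * n%:R - dotp p p]/(u p).
by field; rewrite gt_eqF.
Qed.

Let A_neq0 : A != 0.
Proof.
rewrite -dotp_gt0 dotp_AA mulr_gt0 // ?exprn_gt0 //.
by have := ler0n R n; move: m_gt0; lra.
Qed.

(** A hyperbolic geodesic of the ball is a circular arc or a segment, so it meets its chord at equal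
    angles at both ends; this is that symmetry for the gradients of the distance. *)
Let reflection_A : (u p *: A) *m reflection w = u q *: B.
Proof.
rewrite mul_reflection dotpZl dotpA dotp_pw -/W.
have -> : 2 / W * (u p * (u q * ((u q - u p + W) / 2) + m * W)) =
    m * (u p + u q) + u p * u q.
  by rewrite m_def; field; rewrite gt_eqF.
rewrite /A /B; apply/rowP => i; rewrite !mxE; ring.
Qed.

(** First-order condition with [q] held fixed: the variation along [- e] reads [dotp A e <= 0]. *)
Let A_parallel : A = (dotp A g0 / dotp g0 g0) *: g0.
Proof.
have [g0n0 _ _] := J0; apply: parallel_of_orth => // e eg.
have [||+ _] := @maximiser_variation (- e) 0.
- by rewrite dotpNl eg oppr0.
- by rewrite dotp0l.
- by rewrite dotp0r dotpNr; lra.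
Qed.

Let B_parallel : B = (dotp B g1 / dotp g1 g1) *: g1.
Proof.
have [g1n0 _ _] := J1; apply: parallel_of_orth => // e eg.
have [||+ _] := @maximiser_variation 0 (- e).
- by rewrite dotp0l.
- by rewrite dotpNl eg oppr0.
- by rewrite dotp0r dotpNr; lra.
Qed.

(** The gradients [A] and [B] are normal and mirror images up to scale, so the mirror takes one
    normal line, hence one tangent space, to the other. *)
Let reflection_g0 : exists2 c : R, c != 0 & g0 *m reflection w = c *: g1.
Proof.
have [g0n0 _ _] := J0.
have a0 : dotp A g0 / dotp g0 g0 != 0.
  by apply: contraNneq A_neq0 => a0; rewrite A_parallel a0 scale0r.
move: reflection_A; rewrite {1}A_parallel B_parallel !scalerA -scalemxAl.
move: (dotp A g0 / _) (_ / dotp g1 g1) a0 => a b a0 E.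
have E' : g0 *m reflection w = (u q * b / (u p * a)) *: g1.
  rewrite mulrC -scalerA -E scalerA mulVf ?scale1r // mulf_neq0 // gt_eqF //.
exists (u q * b / (u p * a)) => //.
apply: contraTneq g0n0 => c0; rewrite negbK -dotp_eq0.
by rewrite -(dotp_reflection _ _ pq) E' c0 scale0r dotp0l.
Qed.

(* Moving both points by vectors that are mirror images of each other makes the
   first-derivative terms cancel against the variation of the distance. *)
Let reflected_variation e : dotp e g0 = 0 ->
  - (u p + u q) * dotp e e + quad M0 e / dotp g0 g0 * dotp A g0
  + quad M1 (e *m reflection w) / dotp g1 g1 * dotp B g1 <= 0.
Proof.
move=> eg0; have [c c0 gc] := reflection_g0.
set e' := e *m reflection w.
have eg1 : dotp e' g1 = 0.
  apply/eqP; rewrite -(mulrI_eq0 _ (mulfI c0)) -dotpZr -gc dotp_reflection //.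
  exact/eqP.
have Ae : dotp A e = 0 by rewrite A_parallel dotpZl (dotpC g0 e) eg0 mulr0.
have Be : dotp B e' = 0 by rewrite B_parallel dotpZl (dotpC g1 e') eg1 mulr0.
have [_ +] := maximiser_variation eg0 eg1.
rewrite Ae Be addr0 => /(_ erefl).
have -> : dotp e' e' = dotp e e by rewrite dotp_reflection.
have ee' : e - e' = (2 / W * dotp e w) *: w.
  by rewrite /e' mul_reflection subKr.
have we' : dotp w e' = - dotp w e.
  rewrite /e' mul_reflection dotpDr dotpNr dotpZr -/W (dotpC e).
  by field; rewrite gt_eqF.
have pe : dotp p e = - (m * dotp w e) / u q.
  have := dotpA e; rewrite Ae => /esym/eqP; rewrite addr_eq0 => /eqP H.
  by rewrite -H mulrAC mulfV ?mul1r // gt_eqF.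
have qe : dotp q e' = - (m * dotp w e) / u p.
  have := dotpB e'; rewrite Be we' mulrN opprK => /esym/eqP.
  rewrite addr_eq0 => /eqP H.
  by rewrite -H mulrAC mulfV ?mul1r // gt_eqF.
rewrite ee' dotpZl dotpZr -/W pe qe (dotpC e w).
(* Since [m = u p * u q / W], both [4 * dotp p e * dotp q e'] and [m * dotp (e - e') (e - e')] equal
   [4 * m * dotp w e ^+ 2 / W] and cancel. *)
set d := (X in X <= 0 -> _); set d' := (X in _ -> X <= 0).
suff -> : d = d' by [].
have [g0n0 _ _] := J0; have [g1n0 _ _] := J1.
by rewrite /d /d' m_def; field; rewrite !gt_eqF ?dotp_gt0.
Qed.

Lemma maximiser_absurd : False.
Proof.
have [g0n0 tr0 _] := J0; have [g1n0 tr1 _] := J1.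
have [c _ gc] := reflection_g0.
have : \sum_i (- (u p + u q) * dotp (row i (proj_orth g0)) (row i (proj_orth g0))
    + quad M0 (row i (proj_orth g0)) / dotp g0 g0 * dotp A g0
    + quad M1 (row i (proj_orth g0) *m reflection w) / dotp g1 g1 * dotp B g1) <= 0.
  by apply: sumr_le0 => i _; apply: reflected_variation; exact: dotp_row_proj_orth.
rewrite !big_split /= -mulr_sumr -!mulr_suml sum_dotp_proj_orth //.
rewrite sum_quad_proj_orth // (sum_quad_reflection_proj_orth _ g0n0 pq gc) tr0 tr1.
have -> : 2^-1 * dotp p g0 / dotp g0 g0 * dotp A g0 = dotp A p / 2.
  rewrite [in RHS]A_parallel dotpZl (dotpC g0 p); field.
  by rewrite gt_eqF // dotp_gt0.
have -> : 2^-1 * dotp q g1 / dotp g1 g1 * dotp B g1 = dotp B q / 2.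
  rewrite [in RHS]B_parallel dotpZl (dotpC g1 q); field.
  by rewrite gt_eqF // dotp_gt0.
rewrite dotpA dotpB !(dotpC w) dotp_pw dotp_qw => H.
have mW : m * W = u p * u q by rewrite eq_m.
have p0 := dotp_ge0 p; have q0 := dotp_ge0 q.
(* By [mW] the terms in [m] of [H] add up to [u p * u q / 2]. Writing [4 * n] as [u p + dotp p p] or
   [u q + dotp q q] cancels the products [u p * u q] and leaves
   [u q * dotp p p + u p * dotp q q <= 0]. *)
have Hp : u q * dotp p p <= 0.
  have := mulr_ge0 (ltW up_gt0) q0; move: H mW; rewrite /ball_weight; nra.
have Hq : u p * dotp q q <= 0.
  have := mulr_ge0 (ltW uq_gt0) p0; move: H mW; rewrite /ball_weight; nra.
move: Hp Hq; rewrite !pmulr_rle0 // => Hp Hq.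
move: pq; have /eqP -> : p == 0 by rewrite -dotp_eq0 eq_le Hp.
have /eqP -> : q == 0 by rewrite -dotp_eq0 eq_le Hq.
by rewrite subrr eqxx.
Qed.

End Maximiser.

Lemma continuous_ball_weight : continuous u.
Proof.
move=> x; apply: (@continuousB _ _ _ (cst (4 * n%:R : R)) (fun y : V => dotp y y)).
  exact: cst_continuous.
exact: continuous_sqnorm.
Qed.

End Frankel.

(** * Existence of the maximising pair and conclusion *)

Lemma enorm_le_sqrt (R : realType) (n : nat) (x : 'rV[R]_(n.+1)) :
  (enorm x <= 2 * Num.sqrt n%:R) = (dotp x x <= 4 * n%:R).
Proof.
have -> : 2 * Num.sqrt n%:R = Num.sqrt (4 * n%:R) :> R.
  by rewrite sqrtrM // (_ : 4 = 2 ^+ 2 :> R) ?sqrtr_sqr ?ger0_norm // -natrX.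
by rewrite /enorm ler_sqrt // mulr_ge0 // ler0n.
Qed.

Theorem theorem3 (R : realType) (n : nat) (S0 S1 : set 'rV[R]_(n.+1)) :
  shrinker S0 -> shrinker S1 ->
  exists x : 'rV[R]_(n.+1),
    [/\ enorm x <= 2 * Num.sqrt (n%:R), S0 x & S1 x].
Proof.
move=> sh0 sh1.
have [p0 [S0p0 p0n]] := shrinker_near_origin sh0.
have [p1 [S1p1 p1n]] := shrinker_near_origin sh1.
(* For [n = 0] the open ball is empty, but both closest points are the origin itself. *)
case: (posnP n) => [n0|npos].
  have nR : n%:R = 0 :> R by rewrite n0.
  have E (p : 'rV[R]_n.+1) : dotp p p <= 2 * n%:R -> p = 0.
    by rewrite nR mulr0 => H; apply/eqP; rewrite -dotp_eq0 eq_le dotp_ge0 andbT.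
  rewrite (E _ p0n) in S0p0; rewrite (E _ p1n) in S1p1.
  by exists 0; split=> //; rewrite enorm_le_sqrt dotp0l mulr_ge0 // ler0n.
have nR : 0 < n%:R :> R by rewrite ltr0n.
apply: contrapT => disj.
pose K (S : set 'rV[R]_n.+1) := S `&` [set x | dotp x x <= 4 * n%:R].
have [_ c0 _] := sh0; have [_ c1 _] := sh1.
have K0 : compact (K S0) by exact: compact_closed_sqnorm_le.
have K1 : compact (K S1) by exact: compact_closed_sqnorm_le.
have neq x y : K S0 x -> K S1 y -> 0 < dotp (x - y) (x - y).
  move=> [S0x /= xn] [S1y _]; rewrite dotp_gt0 subr_eq0; apply/eqP => xy.
  by apply: disj; exists x; split=> //; [rewrite enorm_le_sqrt|rewrite xy].
pose f (z : 'rV[R]_n.+1 * 'rV[R]_n.+1) :=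
  ball_weight z.1 * ball_weight z.2 / dotp (z.1 - z.2) (z.1 - z.2).
have Kp : (K S0 `*` K S1) (p0, p1).
  by split; split=> //=; lra.
have cf : {within K S0 `*` K S1, continuous f}.
  apply: continuous_in_subspaceT => z; rewrite inE => -[Kz0 Kz1].
  have cz1 : (fun z : 'rV[R]_n.+1 * 'rV[R]_n.+1 => z.1) @ z --> z.1 by exact: cvg_fst.
  have cz2 : (fun z : 'rV[R]_n.+1 * 'rV[R]_n.+1 => z.2) @ z --> z.2 by exact: cvg_snd.
  apply: cvgM.
    by apply: cvgM; [apply: (cvg_comp _ _ cz1)|apply: (cvg_comp _ _ cz2)];
      exact: continuous_ball_weight.
  apply: cvgV; first by rewrite gt_eqF // neq.
  by apply: cvg_dotp; exact: cvgB.
have [[p q] /=] := compact_EVT_max (ex_intro _ _ Kp) (compact_setX K0 K1) cf.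
rewrite inE => -[/= Kp0 Kq1] fmax.
have {}fmax x y : K S0 x -> K S1 y -> f (x, y) <= f (p, q).
  by move=> Kx Ky; apply: fmax; rewrite inE.
(* The points [p0] and [p1] satisfy [dotp x x <= 2 * n < 4 * n], so the maximum is positive and
   cannot sit on the boundary sphere, where the weight vanishes. *)
have fpos : 0 < f (p, q).
  have [Kp00 Kp11] := Kp; apply: lt_le_trans (fmax _ _ Kp00 Kp11).
  by rewrite /f /= divr_gt0 ?neq // mulr_gt0 // /ball_weight; lra.
have upq : 0 < ball_weight p * ball_weight q.
  by move: fpos; rewrite /f /= pmulr_lgt0 // invr_gt0 neq.
have [S0p pn] := Kp0; have [S1q qn] := Kq1.
have up : 0 < ball_weight p.
  rewrite lt_def; apply/andP; split; last by rewrite /ball_weight subr_ge0.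
  by apply: contraTneq upq => ->; rewrite mul0r ltxx.
have uq : 0 < ball_weight q by move: upq; rewrite pmulr_rgt0.
have [g0 [M0 J0]] := shrinker_jetP sh0 S0p.
have [g1 [M1 J1]] := shrinker_jetP sh1 S1q.
have oU : open [set x : 'rV[R]_n.+1 | 0 < ball_weight x].
  apply: (@open_comp _ _ (@ball_weight R n) [set t | 0 < t]).
    by move=> x _; exact: continuous_ball_weight.
  exact: open_gt.
apply: (maximiser_absurd (m := f (p, q)) (shrinker_jet_setI oU up J0)
  (shrinker_jet_setI oU uq J1)) => //.
- move=> x y [S0x /= ux] [S1y /= uy].
  have Kx : K S0 x by split=> //=; rewrite -subr_ge0 ltW.
  have Ky : K S1 y by split=> //=; rewrite -subr_ge0 ltW.
  by rewrite -ler_pdivrMr ?neq //; exact: fmax.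
- by rewrite /f /= divfK // gt_eqF // neq.
- by rewrite -dotp_gt0 neq.
Qed.
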